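(* Let $\mathbb{F}_q$ be a finite field, let $\mathcal{A}=\{\alpha_1,\ldots,\alpha_r\}\subseteq\mathbb{F}_q$ be a set of $r\ge1$ pairwise distinct evaluation points, and let $V=(v_{i,j})\in(\mathbb{F}_q^\ast)^{2\times r}$. Set $\lambda_j:=v_{1,j}v_{2,j}$ for $1\le j\le r$. The HRS code $C=\operatorname{HRS}_r(\mathcal{A},V,2,r)$ is reverse self-dual if and only if \[ (m+1)\sum_{j=1}^{r}\lambda_j\alpha_j^m=0\quad\text{in }\mathbb{F}_q,\qquad\text{for all } 0\le m\le 2r-3. \]
   Context: For an integer $h\ge 0$, $\mathcal{P}_{<h}=\{f\in\mathbb{F}_q[x]:\deg f<h\}$. Convention: $\alpha^0=1$ for all $\alpha$, including $\alpha=0$. Hasse derivative: for $f(x)=\sum_\ell f_\ell x^\ell\in\mathbb{F}_q[x]$ and $j\ge0$, $\partial^{(j)}f(x)=\sum_{\ell}\binom{\ell}{j}f_\ell x^{\ell-j}$ (with $\binom{\ell}{j}=0$ if $j>\ell$). Hyperderivative Reed–Solomon (HRS) code: for $V=(v_{i,j})\in(\mathbb{F}_q^\ast)^{s\times r}$ and $0\le k\le rs$, \[ \operatorname{HRS}_k(\mathcal{A},V,s,r)=\left\{\bigl(v_{i,j}\,\partial^{(i-1)}f(\alpha_j)\bigr)_{1\le i\le s,\,1\le j\le r}: f\in\mathcal{P}_{<k}\right\}\subseteq\operatorname{Mat}_{s\times r}(\mathbb{F}_q). \] Reverse bilinear form on $\operatorname{Mat}_{s\times r}(\mathbb{F}_q)$: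 $[A,B]_{\rm rev}=\sum_{j=1}^r\sum_{i=1}^s a_{i,j}b_{s-i+1,j}$. The reverse dual of a linear code $C$ is $C^{\perp_{\rm rev}}=\{B:[A,B]_{\rm rev}=0\text{ for all }A\in C\}$, and $C$ is reverse self-dual if $C=C^{\perp_{\rm rev}}$. *)

(* Defs.v *)
From mathcomp Require Import all_boot all_order all_algebra.

Set Implicit Arguments.
Unset Strict Implicit.
Unset Printing Implicit Defensive.

Import GRing.Theory.

Local Open Scope ring_scope.

(** Rows and columns are numbered from 0, so
    row [i : 'I_s] is row [i + 1] in 1-based numbering and carries the
    Hasse derivative of order [i].  The library's [f^`N(n)] is the Hasse
    derivative: its coefficient of degree [l - n] is ['C(l, n)] times that of
    degree [l] in [f] (lemma [coef_nderivn]). *)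

Definition hrs_word (F : finFieldType) (s r : nat) (alpha : 'I_r -> F)
    (V : 'M[F]_(s, r)) (f : {poly F}) : 'M[F]_(s, r) :=
  \matrix_(i < s, j < r) (V i j * (f^`N(i)).[alpha j]).

(** [{poly_k F}] is the finite type of polynomials of size at most [k], i.e.
    of degree less than [k]. *)
Definition HRS (F : finFieldType) (s r k : nat) (alpha : 'I_r -> F)
    (V : 'M[F]_(s, r)) : {set 'M[F]_(s, r)} :=
  [set hrs_word alpha V f | f : {poly_k F}].

(** [rev_ord i] is [s - 1 - i], the 0-based form of [s - i + 1]. *)
Definition rev_form (F : finFieldType) (s r : nat) (A B : 'M[F]_(s, r)) : F :=
  \sum_(j < r) \sum_(i < s) A i j * B (rev_ord i) j.

Definition rev_dual (F : finFieldType) (s r : nat) (C : {set 'M[F]_(s, r)}) :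
    {set 'M[F]_(s, r)} :=
  [set B | [forall A in C, rev_form A B == 0]].

Definition rev_self_dual (F : finFieldType) (s r : nat)
    (C : {set 'M[F]_(s, r)}) : Prop :=
  C = rev_dual C.

(* Main.v *)
Require Import Defs.
From mathcomp Require Import all_boot all_order all_algebra.
From mathcomp Require Import zify ring.

Import GRing.Theory.

Local Open Scope ring_scope.

(** The Leibniz rule turns the form on two codewords into
    [[w f, w g] = \sum_j lambda_j (f * g)'(alpha_j)].  The products of two
    polynomials of degree [< r] span the polynomials of degree [<= 2r - 2], so
    evaluating this functional on monomials gives the stated conditions as the
    criterion for self-orthogonality.  The code is automatically maximal among
    self-orthogonal ones: given [B] in the dual, interpolation yields a
    codeword with the same first row, and the second row of the difference
    pairs to zero with every Lagrange basis polynomial, hence vanishes. *)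

Section Interpolation.

Context {F : fieldType} {r : nat} {alpha : 'I_r -> F}.
Hypothesis alpha_inj : injective alpha.

Lemma exists_lagrange_basis (j0 : 'I_r) :
  exists2 f : {poly F}, (size f <= r)%N & forall j, f.[alpha j] = (j == j0)%:R.
Proof.
pose p := \prod_(j < r | j != j0) ('X - (alpha j)%:P).
have p_neq0 : p.[alpha j0] != 0.
  rewrite horner_prod; apply/prodf_neq0 => j nj.
  by rewrite hornerXsubC subr_eq0 (inj_eq alpha_inj) eq_sym.
exists (p.[alpha j0]^-1 *: p).
  (* There is one linear factor per index other than [j0], so the size is [r.-1.+1]; this equals [r]
     because the existence of [j0] forces [r] to be positive. *)
  rewrite (leq_trans (size_scale_leq _ _)) // /p -big_filter size_prod_XsubC.
  rewrite size_filter -sum1_count.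
  by rewrite sum1_card cardC1 card_ord; have := ltn_ord j0; lia.
move=> j; rewrite hornerZ; have [->|nj] := eqVneq j j0; first by rewrite mulVf.
by rewrite [X in _ * X]horner_prod (bigD1 j) //= hornerXsubC subrr mul0r mulr0.
Qed.

Lemma exists_interpolation (c : 'I_r -> F) :
  exists2 f : {poly F}, (size f <= r)%N & forall j, f.[alpha j] = c j.
Proof.
have [L sL LE] : exists2 L : 'I_r -> {poly F},
    forall i, (size (L i) <= r)%N & forall i j, (L i).[alpha j] = (j == i)%:R.
  have /fin_all_exists2[L ? ?] := exists_lagrange_basis.
  by exists L.
exists (\sum_(i < r) c i *: L i) => [|j].
  apply: (leq_trans (size_sum _ _ _)); apply/bigmax_leqP => i _.
  exact: leq_trans (size_scale_leq _ _) (sL i).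
rewrite horner_sum (bigD1 j) //= hornerZ LE eqxx mulr1 big1 ?addr0 // => i ij.
by rewrite hornerZ LE eq_sym (negPf ij) mulr0.
Qed.

End Interpolation.

Section Codewords.

Context {F : finFieldType} {s r : nat}.
Implicit Types (alpha : 'I_r -> F) (A B : 'M[F]_(s, r)).

Lemma rev_formB A B B' : rev_form A (B - B') = rev_form A B - rev_form A B'.
Proof.
rewrite /rev_form -sumrB; apply: eq_bigr => j _.
by rewrite -sumrB; apply: eq_bigr => i _; rewrite !mxE mulrBr.
Qed.

Lemma mem_HRS k alpha (V : 'M[F]_(s, r)) (f : {poly F}) :
  (size f <= k)%N -> hrs_word alpha V f \in HRS k alpha V.
Proof. by move=> sf; rewrite -(npolypK sf) imset_f. Qed.

(** Lets later arguments test duality on polynomials with a size bound instead of on elements of the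
    code. *)
Lemma mem_rev_dual_HRS k alpha (V : 'M[F]_(s, r)) B :
  (forall f : {poly F}, (size f <= k)%N ->
    rev_form (hrs_word alpha V f) B = 0) <->
  B \in rev_dual (HRS k alpha V).
Proof.
rewrite inE; split=> [BP|/'forall_implyP BP f sf].
  by apply/'forall_implyP => _ /imsetP[f _ ->]; rewrite BP.
exact/eqP/BP/mem_HRS.
Qed.

End Codewords.

Lemma rev_form2 {F : finFieldType} {r : nat} (A B : 'M[F]_(2, r)) :
  rev_form A B =
  \sum_(j < r) (A ord0 j * B ord_max j + A ord_max j * B ord0 j).
Proof.
apply: eq_bigr => j _; rewrite !big_ord_recl big_ord0 addr0.
by congr (A _ _ * B _ _ + A _ _ * B _ _); apply/val_inj.
Qed.

(** Reversal pairs values with derivatives, so both Leibniz terms carry the same weight, the product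
    of the two entries of [V] in column [j]. *)
Lemma rev_form_hrs_word {F : finFieldType} {r : nat} (alpha : 'I_r -> F)
    (V : 'M[F]_(2, r)) (f g : {poly F}) :
  rev_form (hrs_word alpha V f) (hrs_word alpha V g) =
  \sum_(j < r) V ord0 j * V ord_max j * (f * g)^`().[alpha j].
Proof.
rewrite rev_form2; apply: eq_bigr => j _.
by rewrite !mxE !nderivn0 !nderivn1 derivM hornerD !hornerM; ring.
Qed.

(** Expand the derivative in monomials and exchange the sums. The constant term of [h] is lost,
    hence the shift from [n.+1] to [n]. *)
Lemma sum_deriv_horner {F : fieldType} {r : nat} (alpha lambda : 'I_r -> F)
    (h : {poly F}) (n : nat) : (size h <= n.+1)%N ->
  \sum_(j < r) lambda j * h^`().[alpha j] =
  \sum_(m < n) h`_m.+1 * (m.+1%:R * \sum_(j < r) lambda j * alpha j ^+ m).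
Proof.
move=> sh; have sh' : (size h^`() <= n)%N.
  apply/leq_sizeP => i ni; rewrite coef_deriv nth_default ?mul0rn //.
  exact: leq_trans sh _.
under [RHS]eq_bigr do rewrite mulrA big_distrr /=.
rewrite exchange_big /=; apply: eq_bigr => j _.
rewrite (horner_coef_wide _ sh') big_distrr /=; apply: eq_bigr => i _.
by rewrite coef_deriv -mulr_natr; ring.
Qed.

Lemma self_orthogonal_HRS {F : finFieldType} {r : nat} (alpha : 'I_r -> F)
    (V : 'M[F]_(2, r)) :
  (HRS r alpha V \subset rev_dual (HRS r alpha V)) <->
  (forall m : nat, (m + 3 <= 2 * r)%N ->
     m.+1%:R * (\sum_(j < r) V ord0 j * V ord_max j * alpha j ^+ m) = 0).
Proof.
split=> [/subsetP C_dual m lem | lambda0].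
  (* Splits ['X^m.+1] into two monomials of degree below [r], which is possible exactly because
     [m.+1] is at most [2 * r - 2]. *)
  pose a := minn m.+1 r.-1.
  have [sa sb] : (a.+1 <= r)%N /\ ((m.+1 - a).+1 <= r)%N by rewrite /a; lia.
  have /C_dual/mem_rev_dual_HRS orth :
      hrs_word alpha V 'X^(m.+1 - a) \in HRS r alpha V.
    by apply: mem_HRS; rewrite size_polyXn.
  have := orth 'X^a; rewrite size_polyXn rev_form_hrs_word => /(_ sa).
  rewrite -exprD subnKC ?geq_minl // => orth0; rewrite -[RHS]orth0 mulr_sumr.
  by apply: eq_bigr => j _; rewrite derivXn hornerMn hornerXn -mulr_natr; ring.
have orth (f g : {poly F}) : (size f <= r)%N -> (size g <= r)%N ->
    rev_form (hrs_word alpha V f) (hrs_word alpha V g) = 0.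
  (* The product has degree at most [2 * r - 2], so only the sums with [m < 2 * r - 2] occur, and
     the hypothesis covers all of them. *)
  move=> sf sg; have sfg : (size (f * g)%R <= (2 * r - 2).+1)%N.
    by apply: leq_trans (size_polyMleq _ _) _; lia.
  rewrite rev_form_hrs_word (sum_deriv_horner _ _ _ _ sfg) big1 // => m _.
  by rewrite lambda0 ?mulr0 //; have := ltn_ord m; lia.
apply/subsetP => _ /imsetP[g _ ->]; apply/mem_rev_dual_HRS => f sf.
exact: orth.
Qed.

Lemma rev_dual_HRS_sub {F : finFieldType} {r : nat} (alpha : 'I_r -> F)
    (V : 'M[F]_(2, r)) :
    injective alpha -> (forall j, V ord0 j != 0) ->
    HRS r alpha V \subset rev_dual (HRS r alpha V) ->
  rev_dual (HRS r alpha V) \subset HRS r alpha V.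
Proof.
move=> alpha_inj V_neq0 /subsetP C_dual; apply/subsetP => B B_dual.
have [f sf fE] := exists_interpolation alpha_inj (fun j => B ord0 j / V ord0 j).
pose w := hrs_word alpha V f; have w_in : w \in HRS r alpha V by apply: mem_HRS.
have row0 j : (B - w) ord0 j = 0.
  by rewrite !mxE nderivn0 fE mulrC divfK // subrr.
(* The derivatives of the Lagrange polynomial [g] are not controlled, but they only meet row 0 of
   [B - w], which is zero. What remains is the entry at [j] times a nonzero factor. *)
have row1 j : (B - w) ord_max j = 0.
  have [g sg gE] := exists_lagrange_basis alpha_inj j.
  have : rev_form (hrs_word alpha V g) (B - w) = 0.
    rewrite rev_formB (proj2 (mem_rev_dual_HRS _ _ _ _) B_dual g sg).
    by rewrite (proj2 (mem_rev_dual_HRS _ _ _ _) (C_dual _ w_in) g sg) subr0.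
  rewrite rev_form2 (bigD1 j) //= big1 => [|i ij].
    rewrite row0 mulr0 !addr0 mxE nderivn0 gE eqxx mulr1 => /eqP.
    by rewrite mulf_eq0 (negPf (V_neq0 j)) => /eqP.
  by rewrite row0 mulr0 addr0 mxE nderivn0 gE (negPf ij) mulr0 mul0r.
suff -> : B = w by [].
apply/eqP; rewrite -subr_eq0; apply/eqP/matrixP => i j; rewrite [RHS]mxE.
case: (unliftP ord0 i) => [k|] ->; last exact: row0.
(* The lifted index and [ord_max] are both row 1, but agree only through their values. *)
by rewrite ord1 -[RHS](row1 j); congr ((B - w) _ j); apply/val_inj.
Qed.

(* [m + 3 <= 2 * r] is [m <= 2r - 3] over the integers: for [r = 1] the range
   is empty, which truncated subtraction would not give. *)
Theorem theorem10 (F : finFieldType) (r : nat) (alpha : 'I_r -> F)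
    (V : 'M[F]_(2, r))
    (r_gt0 : (0 < r)%N)
    (alpha_inj : injective alpha)
    (V_neq0 : forall (i : 'I_2) (j : 'I_r), V i j != 0) :
  let lambda (j : 'I_r) : F := V ord0 j * V ord_max j in
  rev_self_dual (HRS r alpha V) <->
  (forall m : nat, (m + 3 <= 2 * r)%N ->
     m.+1%:R * (\sum_(j < r) lambda j * alpha j ^+ m) = 0).
Proof.
move=> lambda; split=> [/eqP | /self_orthogonal_HRS C_dual].
  by rewrite eqEsubset => /andP[/self_orthogonal_HRS].
by apply/eqP; rewrite eqEsubset C_dual rev_dual_HRS_sub.
Qed.
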